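(* Let $E$ be a Banach space and let $\nu\colon\mathcal B_E\to[0,+\infty)$ be a set function such that (i) for all $A,B\in\mathcal B_E$, $A\subseteq B$ implies $\nu(A)\le\nu(B)$, and (ii) $\nu(\lambda A+(1-\lambda)B)\le\lambda\nu(A)+(1-\lambda)\nu(B)$ for all $A,B\in\mathcal B_E$ and all $\lambda\in[0,1]$. Then $\nu(\operatorname{conv}A)=\nu(A)$ for every set $A\in\mathcal B_E$ that has the weak Carathéodory property.
   Context: $E$ is a real or complex Banach space and $\mathcal B_E$ is the family of all non-empty bounded subsets of $E$. $\operatorname{conv}A$ is the (not necessarily closed) convex hull; $A+B=\{a+b: a\in A, b\in B\}$, $\lambda A=\{\lambda a: a\in A\}$. A non-empty subset $A$ of a Banach space has the weak Carathéodory property if there exists $\lambda\in(0,1]$ such that $\lambda A+(1-\lambda)\operatorname{conv}A=\operatorname{conv}A$. *)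

(* Defs.v *)
From mathcomp Require Export all_boot all_order all_algebra.
From mathcomp Require Export all_classical all_reals all_analysis.
From mathcomp Require Export complex.

Export Order.TTheory GRing.Theory Num.Theory.
Export numFieldNormedType.Exports.

#[export] Set Implicit Arguments.
#[export] Unset Strict Implicit.
#[export] Unset Printing Implicit Defensive.

Open Scope classical_set_scope.
Open Scope ring_scope.

Variant scalar_kind := RealScalars | ComplexScalars.

Definition scalars (R : realType) (k : scalar_kind) : numFieldType :=
  match k with
  | RealScalars => R
  | ComplexScalars => R[i]
  end.

Definition real_scalar (R : realType) (k : scalar_kind) : R -> scalars R k :=
  match k return R -> scalars R k with
  | RealScalars => fun r => r
  | ComplexScalars => fun r => (r%:C)%C
  end.
Arguments real_scalar {R} k r.

Definition set_sum (V : nmodType) (A B : set V) : set V :=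
  [set a + b | a in A & b in B].

Section RealScaling.
Context (R : realType) (k : scalar_kind) (E : normedModType (scalars R k)).
Implicit Types (l : R) (A B : set E).

Definition set_scale l A : set E := [set real_scalar k l *: a | a in A].

(* The order of R[i] only compares numbers with the same imaginary part, so
   even for complex scalars the coefficients in the library's [convex_set]
   range over the real interval [0, 1]. *)
Definition conv_hull A : set E := smallest (@convex_set (scalars R k) E) A.

Definition nonempty_bounded A : Prop := A !=set0 /\ bounded_set A.

Definition weak_Caratheodory A : Prop :=
  exists l : R, 0 < l <= 1 /\
    set_sum (set_scale l A) (set_scale (1 - l) (conv_hull A)) = conv_hull A.

End RealScaling.

(* Main.v *)
Require Import Defs.

(** Put [C := conv_hull A].  The weak Caratheodory property writes [C] as a
    convex combination of the two sets [A] and [C] in which [A] has the positive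
    weight [l].  Convexity of [nu] then gives
    [nu C <= l * nu A + (1 - l) * nu C], that is [l * nu C <= l * nu A], and
    dividing by [l > 0] yields [nu C <= nu A]; the reverse inequality is
    monotonicity.  For the hypotheses on [nu] to apply to [C], the hull of a
    bounded set must be bounded ([nonempty_bounded_conv_hull]), which holds
    because closed balls around the origin are convex. *)

Lemma convex_set_norm_le (K : numFieldType) (V : normedModType K) (M : K) :
  convex_set [set x : V | `|x| <= M].
Proof.
move=> x y t /set_mem /= xM /set_mem /= yM; apply/mem_set => /=.
have t0 : 0 <= t%:num by [].
have t1 : 0 <= 1 - t%:num by rewrite subr_ge0.
(* Split the bound as M = t * M + (1 - t) * M, to compare termwise. *)
rewrite -[X in _ <= X]mul1r -[X in X * _](subrK t%:num) addrC mulrDl.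
apply: (le_trans (ler_normD _ _)).
by rewrite !normrZ (ger0_norm t0) (ger0_norm t1) lerD // ler_wpM2l.
Qed.

Section ConvexHull.
Context (R : realType) (k : scalar_kind) (E : normedModType (scalars R k)).
Implicit Types A : set E.

Lemma sub_conv_hull A : A `<=` conv_hull A.
Proof. exact: sub_gen_smallest. Qed.

(** Every closed ball around the origin that contains [A] is convex, hence
    contains [conv_hull A]: the same bounds serve for both sets. *)
Lemma bounded_conv_hull A : bounded_set A -> bounded_set (conv_hull A).
Proof.
rewrite /= /bounded_near; apply: filterS => M.
by move=> AM; apply: smallest_sub; first exact: convex_set_norm_le.
Qed.

Lemma nonempty_bounded_conv_hull A :
  nonempty_bounded A -> nonempty_bounded (conv_hull A).
Proof.
move=> [[a Aa] bA]; split; last exact: bounded_conv_hull.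
by exists a; exact: sub_conv_hull.
Qed.

End ConvexHull.

Theorem theorem26 (R : realType) (k : scalar_kind)
    (E : completeNormedModType (scalars R k)) (nu : set E -> R)
    (nu_ge0 : forall A : set E, nonempty_bounded A -> 0 <= nu A)
    (nu_mono : forall A B : set E, nonempty_bounded A -> nonempty_bounded B ->
       A `<=` B -> nu A <= nu B)
    (nu_convex : forall (A B : set E) (l : R),
       nonempty_bounded A -> nonempty_bounded B -> 0 <= l <= 1 ->
       nu (set_sum (set_scale l A) (set_scale (1 - l) B))
         <= l * nu A + (1 - l) * nu B)
    (A : set E) :
  nonempty_bounded A -> weak_Caratheodory A -> nu (conv_hull A) = nu A.
Proof.
move=> bA [l [/andP[l0 l1] defC]].
have bC := nonempty_bounded_conv_hull bA.
apply/le_anti/andP; split; last by apply: nu_mono => //; exact: sub_conv_hull.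
have l01 : 0 <= l <= 1 by rewrite ltW.
have := nu_convex _ _ _ bA bC l01.
by rewrite defC mulrBl mul1r addrCA lerDl subr_ge0 ler_pM2l.
Qed.
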